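(* Let $G=G_n(g,f)$ and $H=G_n(h,\ell)$ be Riordan graphs on the vertex set $[n]$, and let $B_1=\mathcal{B}(tg,f)_n=[r_{ij}]$, $B_2=\mathcal{B}(t,t)_n^T=[g_{ij}]$ and $B_3=\mathcal{B}(th,\ell)_n=[b_{ij}]$ (indices $1\le i,j\le n$). For $i>j$, let $\omega_{ij}$ be the number of RGB-walks from $i$ to $j$ in the RGB-graph $\mathcal{D}(G,H)$. Then, for $i>j$, $$\omega_{ij}=\sum_{k=j}^{i-1} r_{i,k}\,g_{k,k+1}\,b_{k+1,j}.$$ In particular, two vertices $i$ and $j$ (with $i>j$) are adjacent in $G\otimes_R H$ if and only if $\omega_{ij}\equiv 1 \pmod 2$.
   Context: $[t^k]u$ is the coefficient of $t^k$ in a power series $u$. For $u,v\in\mathbb{Z}[[t]]$ (or $\mathbb{Z}_2[[t]]$) with $v(0)=0$, $\mathcal{B}(u,v)_n$ is the $n\times n$ $(0,1)$-matrix whose $(i,j)$ entry ($1\le i,j\le n$) is congruent mod $2$ to $[t^{i-1}]\,u v^{\,j-1}$. The Riordan graph $G_n(g,f)$ (with $f(0)=0$) is the simple graph on $[n]=\{1,\dots,n\}$ with adjacency matrix $B+B^T$, $B=\mathcal{B}(tg,f)_n$. R-product: for simple graphs $G,G'$ on $[n]$ with adjacency matrices $B+B^T$ and $B'+B'^T$ ($B,B'$ being $(0,1)$-lower triangular with zero diagonal), $G\otimes_R G'$ is the graph on $[n]$ with adjacency matrix $B_R+B_R^T$, where $B_R$ is the $(0,1)$-lower triangular matrix with zero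 diagonal such that $B_R(1|n)\equiv B(1|n)B'(1|n) \pmod 2$; here $A(i|j)$ denotes $A$ with its $i$th row and $j$th column deleted. For Riordan graphs, $G_n(g,f)\otimes_R G_n(h,\ell)=G_n(g\cdot h(f),\ell(f))$. RGB-graph: for $G=G_n(g,f)$, $H=G_n(h,\ell)$, the digraph $\mathcal{D}(G,H)$ has vertex set $[n]$ and colored arcs: a red arc from $i$ to $j$ iff the $(i,j)$ entry of $B_1$ is $1$; a green arc from $i$ to $j$ iff the $(i,j)$ entry of $B_2$ is $1$; a blue arc from $i$ to $j$ iff the $(i,j)$ entry of $B_3$ is $1$. An RGB-walk is a directed walk of length $3$ whose first arc is red, second arc is green and third arc is blue. *)

(* Defs.v *)
From HB Require Import structures.
From mathcomp Require Import all_boot all_order all_algebra.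

Set Implicit Arguments.
Unset Strict Implicit.
Unset Printing Implicit Defensive.

Import GRing.Theory.
Local Open Scope ring_scope.

(* A power series is its sequence of coefficients: [t^k] u is u k. *)
Definition fps (R : Type) := nat -> R.

Section PowerSeries.
Variable R : comNzRingType.
Implicit Types u v : fps R.

Definition fps1 : fps R := fun k => (k == 0%N)%:R.
Definition fpsX : fps R := fun k => (k == 1%N)%:R.
Definition fps_mul u v : fps R :=
  fun k => \sum_(i < k.+1) u i * v (k - i)%N.
Definition fps_exp v m : fps R := iter m (fps_mul v) fps1.

(* fps_mul is the product of power series: it extends that of polynomials. *)
Lemma fps_mul_poly (p q : {poly R}) k :
  fps_mul (fun i => p`_i) (fun i => q`_i) k = (p * q)`_k.
Proof. by rewrite coefM. Qed.

Lemma fps_mulXl u k : fps_mul fpsX u k.+1 = u k.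
Proof.
rewrite /fps_mul /fpsX !big_ord_recl /= mul0r add0r /bump /= mul1r subn1 /=.
by rewrite big1 ?addr0 // => i _; rewrite mul0r.
Qed.

Lemma fps_mulXl0 u : fps_mul fpsX u 0 = 0.
Proof. by rewrite /fps_mul big_ord1 /fpsX /= mul0r. Qed.

Lemma fps_mul_ord u v a b :
  (forall k, (k < a)%N -> u k = 0) -> (forall k, (k < b)%N -> v k = 0) ->
  forall k, (k < a + b)%N -> fps_mul u v k = 0.
Proof.
move=> u0 v0 k ltk; rewrite /fps_mul big1 // => i _.
have [lt_ia | le_ai] := ltnP i a; first by rewrite u0 ?mul0r.
by rewrite v0 ?mulr0 // ltn_subLR ?(leq_trans ltk) ?leq_add2r // -ltnS.
Qed.

Lemma fps_exp_ord v m k : v 0%N = 0 -> (k < m)%N -> fps_exp v m k = 0.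
Proof.
move=> v0; elim: m k => // m IHm k ltk.
apply: (@fps_mul_ord _ _ 1 m) => // -[] //.
Qed.

End PowerSeries.

Section RiordanMatrix.
(* The coefficients live in a ring R with a given reduction modulo 2: for
   R = int and for R = 'F_2 there is exactly one such morphism, namely
   z |-> z%:~R and the identity, respectively. *)
Variables (R : comNzRingType) (red : {rmorphism R -> 'F_2}).

(* B(u,v)_n; the row and column of index i : 'I_n are those numbered i + 1
   in the usual numbering from 1. *)
Definition Bmx (u v : fps R) (n : nat) : 'M[nat]_n :=
  \matrix_(i < n, j < n) (red (fps_mul u (fps_exp v j) i) != 0 : nat).

Lemma Bmx_lower g f n (i j : 'I_n) :
  f 0%N = 0 -> (i <= j)%N -> Bmx (fps_mul (fpsX R) g) f n i j = 0%N.
Proof.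
move=> f0 leij; rewrite mxE (@fps_mul_ord _ _ _ 1 j) ?rmorph0 ?eqxx //.
- by move=> [|//] _; rewrite fps_mulXl0.
- by move=> k; apply: fps_exp_ord.
Qed.

End RiordanMatrix.

Lemma Bmx_F2 (u v : fps 'F_2) n (i j : 'I_n) :
  (Bmx idfun u v n i j)%:R = fps_mul u (fps_exp v j) i.
Proof. by rewrite mxE /=; case: (fps_mul _ _ _) => [[|[|[]]]] // ?; apply/val_inj. Qed.

Lemma Bmx_int (u v : fps int) n (i j : 'I_n) :
  ((Bmx intr u v n i j : int) = fps_mul u (fps_exp v j) i %[mod 2])%Z.
Proof.
rewrite mxE; set z := fps_mul _ _ _; apply/eqP; rewrite eqz_mod_dvd.
have red0 (x : int) : ((2 %| x)%Z = (x%:~R == 0 :> 'F_2)).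
  have pch2 := pchar_Fp (isT : prime 2).
  rewrite dvdzE /= (dvdn_pcharf pch2).
  by case: x => m //; rewrite NegzE mulrNz oppr_eq0.
rewrite red0 rmorphB /= subr_eq0.
by case: (z%:~R : 'F_2) => [[|[|[]]]].
Qed.

Record sgraph (n : nat) := SGraph {
  adj :> rel 'I_n;
  adj_sym : symmetric adj;
  adj_irr : irreflexive adj
}.

Definition adjmx n (G : sgraph n) : 'M[nat]_n := \matrix_(i, j) (G i j : nat).

Section GraphOfHalf.
Variables (n : nat) (B : 'M[nat]_n).

Definition half_adj : rel 'I_n := fun i j => (B + B^T) i j == 1%N.

Lemma half_adj_sym : symmetric half_adj.
Proof. by move=> i j; rewrite /half_adj !mxE addrC. Qed.

Lemma half_adj_irr : irreflexive half_adj.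
Proof. by move=> i; rewrite /half_adj !mxE; case: (B i i) => [|[]] // k; rewrite natrDE addnS. Qed.

(* The simple graph with adjacency matrix B + B^T, for B a strictly lower
   triangular (0,1)-matrix (see adjmx_half); meaningless for other B. *)
Definition graph_of_half : sgraph n := SGraph half_adj_sym half_adj_irr.

Definition strict_lower01 :=
  forall i j, (B i j <= 1)%N /\ ((i <= j)%N -> B i j = 0%N).

Lemma adjmx_half : strict_lower01 -> adjmx graph_of_half = B + B^T.
Proof.
move=> lowB; apply/matrixP=> i j; rewrite !mxE /= /half_adj !mxE natrDE.
have [[b1 l1] [b2 l2]] := (lowB i j, lowB j i).
have [leij | /ltnW leji] := leqP i j; last rewrite l2 //.
- by rewrite l1 // add0n; case: (B j i) b2 => [|[]].
- by rewrite addn0; case: (B i j) b1 => [|[]].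
Qed.

End GraphOfHalf.

Definition lowermx n (G : sgraph n) : 'M[nat]_n :=
  \matrix_(i, j) (if (j < i)%N then adjmx G i j else 0%N).

Lemma lowermx01 n (G : sgraph n) : strict_lower01 (lowermx G).
Proof. by move=> i j; rewrite !mxE; case: ltnP => // _; case: (G i j). Qed.

Lemma lowermx_adj n (G : sgraph n) : adjmx G = lowermx G + (lowermx G)^T.
Proof.
apply/matrixP=> i j; rewrite !mxE natrDE adj_sym.
by case: ltngtP => // [_|/val_inj->]; rewrite ?addn0 ?adj_irr // adj_sym.
Qed.

Lemma lowermx_half n (B : 'M[nat]_n) :
  strict_lower01 B -> lowermx (graph_of_half B) = B.
Proof.
move=> lowB; apply/matrixP=> i j; rewrite mxE adjmx_half // !mxE natrDE.
have [[b1 l1] [b2 l2]] := (lowB i j, lowB j i).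
by case: ltnP => [/ltnW/l2-> | /l1->] //; rewrite addn0.
Qed.

Section RiordanGraph.
Variables (R : comNzRingType) (red : {rmorphism R -> 'F_2}).

Definition riordan_graph (n : nat) (g f : fps R) : sgraph n :=
  graph_of_half (Bmx red (fps_mul (fpsX R) g) f n).

Lemma Bmx_lower01 n g f :
  f 0%N = 0 -> strict_lower01 (Bmx red (fps_mul (fpsX R) g) f n).
Proof.
move=> f0 i j; split; last exact: Bmx_lower.
by rewrite mxE; case: (_ != _).
Qed.

Lemma adjmx_riordan n g f (B := Bmx red (fps_mul (fpsX R) g) f n) :
  f 0%N = 0 -> adjmx (riordan_graph n g f) = B + B^T.
Proof. by move=> f0; apply/adjmx_half/Bmx_lower01. Qed.

End RiordanGraph.

Section RProduct.
Variable n : nat.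

(* A(1|n) for a matrix A of order n.+1: first row and last column deleted. *)
Definition cutmx (A : 'M[nat]_n.+1) : 'M[nat]_n := row' ord0 (col' ord_max A).

(* The entries outside the rows and columns kept by cutmx are those of the
   first row and of the last column, which vanish by strict triangularity. *)
Definition Rprod_mx (B B' : 'M[nat]_n.+1) : 'M[nat]_n.+1 :=
  \matrix_(i, j)
    (if (unlift ord0 i, unlift ord_max j) is (Some a, Some b)
     then ((cutmx B *m cutmx B') a b %% 2)%N else 0%N).

Definition Rprod (G G' : sgraph n.+1) : sgraph n.+1 :=
  graph_of_half (Rprod_mx (lowermx G) (lowermx G')).

Lemma cutmx_Rprod_mx (B B' : 'M[nat]_n.+1) a b :
  cutmx (Rprod_mx B B') a b = (cutmx B *m cutmx B') a b %[mod 2].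
Proof. by rewrite /cutmx 3!mxE !liftK modn_mod. Qed.

Lemma Rprod_mx_lower01 B B' :
  strict_lower01 B -> strict_lower01 B' -> strict_lower01 (Rprod_mx B B').
Proof.
move=> lowB lowB' i j; rewrite mxE.
case: unliftP => [a ->|//]; case: unliftP => [b ->|//].
split=> [|leab]; first by rewrite -ltnS ltn_mod.
rewrite mxE big1 ?mod0n // => c _; rewrite !mxE.
have [leac | ltca] := leqP a.+1 c.
  by rewrite (proj2 (lowB _ _)) ?mul0r //= /bump /= [(n <= c)%N]leqNgt ltn_ord.
rewrite (proj2 (lowB' _ _)) ?mulr0 //.
move: leab; rewrite /= /bump /= !add1n => /(leq_trans _); apply.
exact: ltca.
Qed.

Lemma Rprod_mx_unique B B' C :
    strict_lower01 C ->
    (forall a b, cutmx C a b = (cutmx B *m cutmx B') a b %[mod 2]) ->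
  C = Rprod_mx B B'.
Proof.
move=> lowC eqC; apply/matrixP=> i j; rewrite mxE.
case: unliftP => [a ->|->]; last exact: (proj2 (lowC _ _)).
case: unliftP => [b ->|->]; last by apply: (proj2 (lowC _ _)); rewrite -ltnS.
by rewrite -eqC /cutmx 2!mxE modn_small // ltnS; have [] := lowC (lift ord0 a) (lift ord_max b).
Qed.

Lemma adjmx_Rprod (G G' : sgraph n.+1) (BR := Rprod_mx (lowermx G) (lowermx G')) :
  adjmx (Rprod G G') = BR + BR^T.
Proof. by apply/adjmx_half/Rprod_mx_lower01; apply: lowermx01. Qed.

End RProduct.

Variant color := Red | Green | Blue.

(* D c i j: there is an arc of color c from i to j. *)
Definition colored_digraph (n : nat) := color -> rel 'I_n.

Definition RGB_digraph n (B1 B2 B3 : 'M[nat]_n) : colored_digraph n :=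
  fun c i j => match c with
               | Red => B1 i j == 1%N
               | Green => B2 i j == 1%N
               | Blue => B3 i j == 1%N
               end.

Definition is_RGB_walk n (D : colored_digraph n) (i j : 'I_n)
    (w : 'I_n * 'I_n * 'I_n * 'I_n) : bool :=
  let: (v0, v1, v2, v3) := w in
  [&& v0 == i, v3 == j, D Red v0 v1, D Green v1 v2 & D Blue v2 v3].

Definition num_RGB_walks n (D : colored_digraph n) (i j : 'I_n) : nat :=
  #|[set w | is_RGB_walk D i j w]|.

(* Main.v *)
Require Import Defs.
From mathcomp Require Import all_boot all_order all_algebra.
Import GRing.Theory.
Local Open Scope ring_scope.

(** Counting walks colour by colour turns the number of RGB-walks from [i] to
    [j] into the entry of the integer matrix product [B1 *m B2 *m B3]. The
    green matrix is the transpose of [B(t,t)], whose column [k] is the power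
    series [t^(k+1)]; hence the green arcs are exactly the steps [k -> k+1],
    and inserting the green matrix between [B1] and [B3] pairs column [k] of
    [B1] with row [k+1] of [B3]. This is precisely the effect of deleting the
    first row and the last column of both factors before multiplying them, so
    the number of walks is an entry of [cutmx B1 *m cutmx B3]
    ([mulmx_succmx]).

    Both claims follow. As [B1] and [B3] are strictly lower triangular, a red
    arc [i -> k] forces [k < i] and a blue arc [k+1 -> j] forces [j <= k],
    which leaves the range [j <= k < i] of the sum. Modulo 2 the same matrix
    entry is the one defining the R-product. *)

(** The walks from [i] to [j] are parametrized by their two inner vertices,
    and a (0,1) coefficient is the indicator of its arc. *)
Lemma num_RGB_walks_mulmx (n : nat) (B1 B2 B3 : 'M[nat]_n) (i j : 'I_n) :
    (forall u v, B1 u v <= 1)%N -> (forall u v, B2 u v <= 1)%N ->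
    (forall u v, B3 u v <= 1)%N ->
  num_RGB_walks (RGB_digraph B1 B2 B3) i j = (B1 *m B2 *m B3) i j.
Proof.
move=> le1 le2 le3; set D := RGB_digraph B1 B2 B3.
pose inner (p : 'I_n * 'I_n) := (i, p.1, p.2, j).
have -> : num_RGB_walks D i j = #|[set p | is_RGB_walk D i j (inner p)]|.
  rewrite /num_RGB_walks -(@card_imset _ _ inner); last first.
    by move=> [u v] [u' v'] [-> ->].
  congr #|pred_of_set _|; apply/setP=> -[[[v0 v1] v2] v3].
  apply/idP/imsetP => [|[p + ->]]; last by rewrite !inE.
  rewrite inE => walk_w; exists (v1, v2).
    by move: walk_w; rewrite inE /= => /and3P[/eqP<- /eqP<-]; rewrite !eqxx.
  by move: walk_w => /and3P[/eqP-> /eqP->].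
rewrite -sum1_card big_mkcond /= mxE.
under [RHS]eq_bigr => v _ do rewrite mxE mulr_suml.
rewrite [RHS]exchange_big pair_bigA /=; apply: eq_bigr => -[u v] _ /=.
have bitE x : (x <= 1)%N -> x = (x == 1%N) by case: x => [|[]].
rewrite inE /= !eqxx /= (bitE _ (le1 i u)) (bitE _ (le2 u v)) (bitE _ (le3 v j)).
by rewrite !eqb1; do 3!case: (_ == 1%N).
Qed.

Lemma fps_exp_fpsX (R : comNzRingType) (m k : nat) :
  fps_exp (fpsX R) m k = (k == m)%:R.
Proof.
elim: m k => [|m IHm] [|k] //; first by rewrite /= fps_mulXl0.
by rewrite /= fps_mulXl IHm.
Qed.

Definition succmx (n : nat) : 'M[nat]_n :=
  \matrix_(u, v) ((v : nat) == u.+1 : nat).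

Lemma tr_Bmx_fpsX (R : comNzRingType) (red : {rmorphism R -> 'F_2}) (n : nat) :
  (Bmx red (fpsX R) (fpsX R) n)^T = succmx n.
Proof.
apply/matrixP=> u v; rewrite !mxE -[fps_mul _ _]/(fps_exp (fpsX R) u.+1).
by rewrite fps_exp_fpsX rmorph_nat; case: (_ == u.+1).
Qed.

(** Right multiplication by [succmx] shifts the columns of [A]: column [0]
    becomes zero, so that row [0] of [C] is ignored, and the last column of
    [A] is lost. *)
Lemma mulmx_succmx (n : nat) (A C : 'M[nat]_n.+1) (a b : 'I_n) :
  (A *m succmx n.+1 *m C) (lift ord0 a) (lift ord_max b)
    = (cutmx A *m cutmx C) a b.
Proof.
rewrite mxE big_ord_recl [X in X * _]mxE big1 => [|u _]; last first.
  by rewrite mxE mulr0.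
rewrite mul0r add0r [RHS]mxE; apply: eq_bigr => c _.
rewrite mxE (bigD1 (lift ord_max c)) //= big1 => [|u ne_uc]; last first.
  rewrite mxE /= /bump add1n eqSS; case: eqP => [eq_cu|_]; last exact: mulr0.
  by case/eqP: ne_uc; apply/ord_inj; rewrite lift_max.
by rewrite addr0 !mxE lift_max lift0 eqxx mulr1.
Qed.

(** Strict triangularity kills the summands in which the red arc or the blue
    arc would not descend. *)
Lemma mulmx_cutmx_range (n : nat) (A C : 'M[nat]_n.+1) (a b : 'I_n) :
    strict_lower01 A -> strict_lower01 C ->
  (cutmx A *m cutmx C) a b
    = \sum_(b <= k < a.+1) A (lift ord0 a) (inord k)
                           * C (inord k.+1) (lift ord_max b).
Proof.
move=> lowA lowC.
transitivity (\sum_(0 <= k < n) A (lift ord0 a) (inord k)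
                                * C (inord k.+1) (lift ord_max b)).
  rewrite mxE big_mkord; apply: eq_bigr => c _; rewrite !mxE.
  congr (A _ _ * C _ _); apply/ord_inj; rewrite inordK ?lift_max ?lift0 ?ltnS //.
  exact: ltnW.
rewrite [RHS](big_nat_widen _ _ n) // [RHS](big_nat_widenl _ 0) //=.
rewrite [RHS]big_mkcond /=; apply: eq_big_nat => k /= ltkn.
case: ifP => // /negbT; rewrite negb_and -leqNgt -ltnNge => /orP[le_ak | lt_kb].
  by rewrite (proj2 (lowA _ _)) ?mul0r // inordK ?lift0 // ltnS ltnW.
by rewrite (proj2 (lowC _ _)) ?mulr0 // inordK ?lift_max.
Qed.

Lemma Rprod_adj_lt (n : nat) (G H : sgraph n.+1) (i j : 'I_n.+1) :
  (j < i)%N -> adj (Rprod G H) i j = (Rprod_mx (lowermx G) (lowermx H) i j == 1%N).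
Proof.
move=> ltji; rewrite /= /half_adj mxE [X in _ + X]mxE.
have lowR := Rprod_mx_lower01 (lowermx01 G) (lowermx01 H).
by rewrite [X in _ + X](proj2 (lowR _ _)) ?addr0 // ltnW.
Qed.

Theorem theorem2p20 (R : comNzRingType) (red : {rmorphism R -> 'F_2}) (n : nat)
    (g f h l : fps R) (f0 : f 0%N = 0) (l0 : l 0%N = 0) (i j : 'I_n.+1) :
  (j < i)%N ->
  let G := riordan_graph red n.+1 g f in
  let H := riordan_graph red n.+1 h l in
  let B1 := Bmx red (fps_mul (fpsX R) g) f n.+1 in
  let B2 := (Bmx red (fpsX R) (fpsX R) n.+1)^T in
  let B3 := Bmx red (fps_mul (fpsX R) h) l n.+1 in
  let omega := num_RGB_walks (RGB_digraph B1 B2 B3) i j in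
  omega = (\sum_(j <= k < i)
             B1 i (inord k) * B2 (inord k) (inord k.+1) * B3 (inord k.+1) j)%N
  /\ (adj (Rprod G H) i j <-> omega = 1 %[mod 2]).
Proof.
move=> ltji G H B1 B2 B3 omega.
have lowB1 : strict_lower01 B1 by apply: Bmx_lower01.
have lowB3 : strict_lower01 B3 by apply: Bmx_lower01.
have B2E : B2 = succmx n.+1 by apply: tr_Bmx_fpsX.
(* As j < i, the row of i and the column of j are among those kept by cutmx. *)
have [a def_i] : exists a, i = lift ord0 a.
  by case: (unliftP ord0 i) ltji => [a -> | ->] //; exists a.
have [b def_j] : exists b, j = lift ord_max b.
  case: (unliftP ord_max j) ltji => [b -> | ->]; first by exists b.
  by rewrite ltnNge -ltnS ltn_ord.
have omegaE : omega = (cutmx B1 *m cutmx B3) a b.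
  rewrite /omega num_RGB_walks_mulmx ?B2E ?def_i ?def_j ?mulmx_succmx // => u v.
  - by case: (lowB1 u v).
  - by rewrite mxE; case: (_ == _).
  - by case: (lowB3 u v).
split.
  rewrite omegaE mulmx_cutmx_range // -def_i -def_j.
  have -> : (b : nat) = j by rewrite def_j lift_max.
  have -> : a.+1 = i by rewrite def_i lift0.
  apply: eq_big_nat => k /andP[_ ltki].
  have ltkn : (k.+1 < n.+1)%N by apply: leq_ltn_trans (ltn_ord i).
  rewrite B2E [succmx _ _ _]mxE !inordK ?eqxx ?muln1 //.
  exact: ltnW.
rewrite Rprod_adj_lt // !lowermx_half // omegaE def_i def_j mxE !liftK.
by split=> /eqP.
Qed.
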